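(* Let $n\ge 1$, $N=2^n$, and let $B\sim \mathrm{B}(N,\Sigma_S)$ be a random nonsimple scalar butterfly matrix formed with independent uniform angles. Then the permutation $\sigma(B)$ produced by Gaussian elimination with partial pivoting on $B$ is uniformly distributed on the group $B_N\subset S_N$ of nonsimple binary butterfly permutations, i.e. $\sigma(B)\sim\mathrm{Unif}(B_N)$.
   Context: GEPP permutation: Gaussian elimination with partial pivoting (GEPP) applied to a matrix $A$ swaps, at step $k$, row $k$ with row $i_k=\min(\arg\max_{j\ge k}|A^{(k)}_{jk}|)$ of the current intermediate matrix $A^{(k)}$, then eliminates below the diagonal in column $k$. This gives $PA=LU$ with $P$ a permutation matrix, $L$ unit lower triangular, $U$ upper triangular. $\sigma(A)$ is the permutation with $P=P_{\sigma(A)}$, where $P_\sigma \mathbf e_k=\mathbf e_{\sigma(k)}$. Random butterfly matrices: $R_\theta=\begin{bmatrix}\cos\theta&\sin\theta\\-\sin\theta&\cos\theta\end{bmatrix}$. The law $\mathrm{B}(N,\Sigma_S)$, $N=2^n$, is defined recursively: $\mathrm B(1,\Sigma_S)$ is the $1\times1$ matrix $1$, and $B\sim \mathrm B(N,\Sigma_S)$ is $B=(R_\theta\otimes\mathbf I_{N/2})(A_1\oplus A_2)$ with $\theta\sim\mathrm{Unif}([0,2\pi))$, $A_1,A_2\sim\mathrm B(N/2,\Sigma_S)$, and $\theta,A_1,A_2$ independent ($\otimes$ is the Kronecker product, $\oplus$ the block diagonal sum). Butterfly permutations: for permutations, $\sigma_1\oplus\sigma_2$ and $\sigma_1\otimes\sigma_2$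 are the permutations with $P_{\sigma_1\oplus\sigma_2}=P_{\sigma_1}\oplus P_{\sigma_2}$ and $P_{\sigma_1\otimes\sigma_2}=P_{\sigma_1}\otimes P_{\sigma_2}$; $1_k$ is the identity of $S_k$. The group $B_N\subset S_N$ is defined by $B_2=S_2$ and $B_N=\{(\sigma_1\oplus\sigma_2)(\tau\otimes 1_{N/2}):\sigma_1,\sigma_2\in B_{N/2},\ \tau\in S_2\}$, the semidirect product of $B_{N/2}\oplus B_{N/2}$ with $\langle(1\ 2)\otimes1_{N/2}\rangle$, which acts by swapping the two summands. *)

(* Defs.v *)
From HB Require Import structures.
From mathcomp Require Import all_boot all_order all_algebra all_fingroup.
From mathcomp Require Import mxtens.
From mathcomp Require Import all_classical all_reals all_analysis.
From mathcomp Require Import measurable_realfun.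

Set Implicit Arguments.
Unset Strict Implicit.
Unset Printing Implicit Defensive.

Import Order.TTheory GRing.Theory Num.Theory.
Import numFieldNormedType.Exports.

Local Open Scope ring_scope.

(* Permutations act by [P_s e_k = e_(s k)], hence [P_(s o t) = P_s P_t].
   MathComp's [perm_mx] is the transpose convention, and [(t * s)%g] is the
   function [s o t]. *)

Section PermutationMatrices.

Definition pmatrix (R : pzSemiRingType) m (s : 'S_m) : 'M[R]_m :=
  \matrix_(i, j) (i == s j)%:R.

Lemma pmatrixE (R : pzSemiRingType) m (s : 'S_m) :
  pmatrix R s = perm_mx s^-1%g.
Proof.
apply/matrixP => i j; rewrite !mxE; congr (_%:R); congr nat_of_bool.
by rewrite -[RHS](inj_eq (@perm_inj _ s)) permKV.
Qed.

Lemma pmatrix_col (R : pzSemiRingType) m (s : 'S_m) (k : 'I_m) :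
  pmatrix R s *m delta_mx k 0 = delta_mx (s k) 0 :> 'cV[R]_m.
Proof.
apply/matrixP => i j; rewrite !mxE (bigD1 k) //= !mxE !eqxx /= big1.
  by rewrite addr0 ord1 eqxx andbT mulr1.
by move=> l /negPf lk; rewrite !mxE lk /= mulr0.
Qed.

Lemma pmatrixM (R : pzSemiRingType) m (s t : 'S_m) :
  pmatrix R (t * s)%g = pmatrix R s *m pmatrix R t.
Proof. by rewrite !pmatrixE invMg perm_mxM. Qed.

Definition osum_fun m n (s1 : 'S_m) (s2 : 'S_n) (i : 'I_(m + n)) : 'I_(m + n) :=
  match fintype.split i with
  | inl j => lshift n (s1 j)
  | inr j => rshift m (s2 j)
  end.

Lemma osum_fun_inj m n (s1 : 'S_m) (s2 : 'S_n) : injective (osum_fun s1 s2).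
Proof.
move=> i j; rewrite /osum_fun -{2}[i]splitK -{2}[j]splitK.
case: (fintype.split i) => i'; case: (fintype.split j) => j' /=.
- by move/lshift_inj/perm_inj->.
- by move/eqP; rewrite eq_lrshift.
- by move/eqP; rewrite eq_rlshift.
- by move/rshift_inj/perm_inj->.
Qed.

Definition osum m n (s1 : 'S_m) (s2 : 'S_n) : 'S_(m + n) :=
  perm (@osum_fun_inj m n s1 s2).

Lemma pmatrix_osum (R : pzSemiRingType) m n (s1 : 'S_m) (s2 : 'S_n) :
  pmatrix R (osum s1 s2) = block_mx (pmatrix R s1) 0 0 (pmatrix R s2).
Proof.
apply/matrixP => i j; rewrite mxE permE /osum_fun.
case: (split_ordP i) => i' ->; case: (split_ordP j) => j' ->;
  rewrite ?(unsplitK (inl _)) ?(unsplitK (inr _)) ?block_mxEul ?block_mxEur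
    ?block_mxEdl ?block_mxEdr ?eq_lshift ?eq_rshift ?eq_lrshift ?eq_rlshift
    ?mxE //.
Qed.

Definition tens_fun m n (s : 'S_m) (t : 'S_n) (i : 'I_(m * n)) : 'I_(m * n) :=
  mxtens_index (s (mxtens_unindex i).1, t (mxtens_unindex i).2).

Lemma tens_fun_inj m n (s : 'S_m) (t : 'S_n) : injective (tens_fun s t).
Proof.
move=> i j; case: (mxtens_indexP i) => i1 i2; case: (mxtens_indexP j) => j1 j2.
rewrite /tens_fun !mxtens_indexK /=.
by move=> /(can_inj (@mxtens_indexK _ _)) [/perm_inj-> /perm_inj->].
Qed.

Definition tens m n (s : 'S_m) (t : 'S_n) : 'S_(m * n) :=
  perm (@tens_fun_inj m n s t).

Lemma pmatrix_tens (R : pzRingType) m n (s : 'S_m) (t : 'S_n) :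
  pmatrix R (tens s t) = pmatrix R s *t pmatrix R t.
Proof.
apply/matrixP => i j; case: (mxtens_indexP i) => i1 i2.
rewrite !mxE permE /tens_fun mxtens_indexK /= -natrM mulnb -xpair_eqE.
by rewrite (can_eq (@mxtens_indexK _ _)).
Qed.

End PermutationMatrices.

Section Butterfly_permutations.

Lemma double_exp n : (2 ^ n + 2 ^ n = 2 ^ n.+1)%N.
Proof. by rewrite expnS mul2n addnn. Qed.

Definition butterfly_perm_step n (G : {set 'S_(2 ^ n)}) : {set 'S_(2 ^ n.+1)} :=
  [set s | [exists s1 in G, exists s2 in G, exists t : 'S_2,
     s == (cast_perm (esym (expnS 2 n)) (tens t (1 : 'S_(2 ^ n))%g)
           * cast_perm (double_exp n) (osum s1 s2))%g]]%SET.

(* [butterfly_perms n] is $B_N$ with $N = 2^n$; the value at [n = 0] is not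
   used in building the others. *)
Fixpoint butterfly_perms n : {set 'S_(2 ^ n)} :=
  if n is k.+1 then
    if k == 0%N then [set: 'S_(2 ^ k.+1)]
    else butterfly_perm_step (butterfly_perms k)
  else [set: 'S_(2 ^ 0)].

End Butterfly_permutations.

Section GEPP.
Variables (R : realFieldType) (m : nat).
Implicit Types (A U V : 'M[R]_m) (k : 'I_m).

Definition gepp_argmax k A : {set 'I_m} :=
  [set j : 'I_m | (k <= j)%N &
     [forall l : 'I_m, (k <= l)%N ==> (`|A l k| <= `|A j k|)]]%SET.

(* The inner [arg max] only serves as a witness that the set is nonempty. *)
Definition gepp_pivot k A : 'I_m :=
  [arg min_(i < [arg max_(j > k | (k <= j)%N) `|A j k| ]%O in gepp_argmax k A)
     (i : nat)].

Lemma gepp_pivotP k A :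
  gepp_pivot k A \in gepp_argmax k A /\
  (forall j, j \in gepp_argmax k A -> gepp_pivot k A <= j)%N.
Proof.
rewrite /gepp_pivot; case: arg_minnP => //; rewrite inE.
case: arg_maxP => //= j kj jmax; rewrite kj /=.
by apply/forallP => l; apply/implyP => /jmax.
Qed.

(* On a zero pivot column, [x / 0 = 0] makes the step void. *)
Definition gepp_elim k A : 'M[R]_m :=
  \matrix_(i, j)
    if (k < i)%N then A i j - A i k / A k k * A k j else A i j.

(* The state is the current matrix with the accumulated row permutation: the
   permutation matrix is multiplied on the left by the new transposition. *)
Definition gepp_step (st : 'M[R]_m * 'S_m) k : 'M[R]_m * 'S_m :=
  let i := gepp_pivot k st.1 in
  (gepp_elim k (xrow k i st.1), (st.2 * tperm k i)%g).

Definition gepp A : 'M[R]_m * 'S_m := foldl gepp_step (A, 1%g) (enum 'I_m).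

Definition gepp_perm A : 'S_m := (gepp A).2.

Definition unit_lower A : Prop :=
  (forall i, A i i = 1) /\ (forall i j : 'I_m, (i < j)%N -> A i j = 0).

Definition upper A : Prop := forall i j : 'I_m, (j < i)%N -> A i j = 0.

Let inv A (n : nat) (st : 'M[R]_m * 'S_m) :=
  (exists L, [/\ unit_lower L,
     forall i j : 'I_m, (n <= j)%N -> L i j = (i == j)%:R &
     pmatrix R st.2 *m A = L *m st.1]) /\
  (forall i j : 'I_m, (j < n)%N -> (j < i)%N -> st.1 i j = 0).

Let inv_step A k st : inv A k st -> inv A k.+1 (gepp_step st k).
Proof.
case: st => U s [[L [[L1 L0] Lk /= PA]] U0].
rewrite /gepp_step /=; set i := gepp_pivot k U.
have [] := gepp_pivotP k U; rewrite -/i inE => /andP[ki /forallP imax] _.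
set t := tperm k i; set V := xrow k i U.
have VE a b : V a b = U (t a) b by rewrite /V /xrow mxE.
have tlt (a : 'I_m) : (a < k)%N -> t a = a.
  by move=> ak; rewrite tpermD // -val_eqE /= gtn_eqF // (leq_trans ak).
have tge (a : 'I_m) : (k <= a)%N -> (k <= t a)%N.
  by move=> ka; rewrite /t; case: tpermP.
pose L2 : 'M[R]_m := \matrix_(a, b) L (t a) (t b).
pose M : 'M[R]_m :=
  \matrix_(a, b) ((a == b)%:R + ((b == k) && (k < a)%N)%:R * (V a k / V k k)).
have L2k (a b : 'I_m) : (k <= b)%N -> L2 a b = (a == b)%:R.
  by move=> kb; rewrite mxE Lk ?tge // (inj_eq perm_inj).
have ME : M *m gepp_elim k V = V.
  apply/matrixP => a b; rewrite !mxE (bigD1 a) //= !mxE eqxx.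
  have [ka|ak] := ltnP k a; last first.
    rewrite andbF mul0r addr0 mul1r big1 ?addr0 // => c ca.
    by rewrite !mxE eq_sym (negPf ca) ltnNge ak andbF mul0r add0r mul0r.
  have nak : a != k by rewrite -val_eqE /= gtn_eqF.
  rewrite (bigD1 k) ?(eq_sym k) //= !mxE !eqxx ltnn ka (negPf nak) /=.
  rewrite big1 ?addr0 => [|c /andP[ca ck]]; last first.
    by rewrite !mxE eq_sym (negPf ca) (negPf ck) /= mul0r add0r mul0r.
  by rewrite mul0r addr0 mul1r add0r mul1r subrK.
have L'E a b : (L2 *m M) a b =
    L2 a b + ((b == k) && (k < a)%N)%:R * (V a k / V k k).
  rewrite mxE; under eq_bigr => c _ do rewrite [M _ _]mxE mulrDr.
  rewrite big_split /=; congr (_ + _).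
    rewrite (bigD1 b) //= eqxx mulr1 big1 ?addr0 // => c cb.
    by rewrite (negPf cb) mulr0.
  rewrite (bigD1 a) //= big1 ?addr0.
    case: (ltnP k a) => ka; last by rewrite andbF !mul0r mulr0.
    by rewrite (L2k _ _ (ltnW ka)) eqxx mul1r.
  move=> c ca; case: (ltnP k c) => kc; last by rewrite andbF mul0r mulr0.
  by rewrite (L2k _ _ (ltnW kc)) eq_sym (negPf ca) mul0r.
split.
  exists (L2 *m M); split.
  - split=> [a|a b ab]; rewrite L'E.
      rewrite mxE L1; case: eqP => [->|_]; rewrite ?ltnn mul0r addr0 //.
    rewrite [X in _ + X](_ : _ = 0) ?addr0; last first.
      case: eqP => [bk|_]; last by rewrite mul0r.
      by rewrite ltnNge ltnW ?mul0r // -bk.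
    have [kb|bk] := leqP k b; first by rewrite L2k // -val_eqE /= ltn_eqF.
    by rewrite mxE !tlt ?L0 // (ltn_trans ab).
  - move=> a b kb; rewrite L'E (L2k _ _ (ltnW kb)).
    by rewrite (_ : (b == k) = false) ?mul0r ?addr0 // -val_eqE /= gtn_eqF.
  - rewrite /= pmatrixM -mulmxA PA -mulmxA ME.
    have -> : L2 = pmatrix R t *m L *m pmatrix R t.
      rewrite !pmatrixE tpermV -row_permE.
      have -> : perm_mx t = perm_mx t^-1 :> 'M[R]_m by rewrite tpermV.
      by rewrite -col_permE; apply/matrixP => a b; rewrite !mxE.
    have -> : V = pmatrix R t *m U.
      by rewrite pmatrixE tpermV -row_permE; apply/matrixP => a b; rewrite !mxE.
    rewrite -!mulmxA; congr (_ *m (_ *m _)).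
    by rewrite mulmxA -pmatrixM tperm2 pmatrixE invg1 perm_mx1 mul1mx.
move=> a b bk ba; rewrite mxE.
have V0 (c d : 'I_m) : (d < k)%N -> (d < c)%N -> V c d = 0.
  move=> dk dc; rewrite VE U0 //; have [kc|ck] := leqP k c.
    exact: leq_trans dk (tge _ kc).
  by rewrite tlt.
move: bk; rewrite ltnS leq_eqVlt => /orP[/eqP/val_inj bk|bk].
  rewrite -bk ba bk; have [Vk0|Vk] := eqVneq (V k k) 0.
    have : `|V a k| <= 0.
      have:= imax (t a); rewrite tge ?implyTb; last by rewrite -bk ltnW.
      by rewrite -VE -[X in _ <= `|U X k|](tpermL k i) -/t -VE Vk0 normr0.
    by rewrite normr_le0 => /eqP ->; rewrite mul0r mul0r subrr.
  by rewrite divfK // subrr.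
by rewrite (V0 a b) // (V0 k b) // mulr0 subrr if_same.
Qed.

Lemma gepp_LU A : exists L U : 'M[R]_m,
  [/\ unit_lower L, upper U & pmatrix R (gepp_perm A) *m A = L *m U].
Proof.
suff [[L [? _ PA]] U0] : inv A m (gepp A).
  by exists L, (gepp A).1; split=> // i j; apply: U0.
have H n : (n <= m)%N -> inv A n (foldl gepp_step (A, 1%g) (take n (enum 'I_m))).
  elim: n => [_|n IH nm].
    rewrite take0 /=; split=> //; exists 1%:M; split=> //.
    - split=> [i|i j ij]; rewrite !mxE ?eqxx // -val_eqE /= ltn_eqF //.
    - by move=> i j _; rewrite mxE.
    - by rewrite pmatrixE invg1 perm_mx1.
  rewrite (take_nth (Ordinal nm)) ?size_enum_ord // -cats1 foldl_cat /=.
  set k := nth _ _ _; have kn : n = k by rewrite /k nth_enum_ord.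
  rewrite [in n.+1]kn; apply: inv_step; rewrite -kn; apply: IH.
  exact: ltnW.
by have := H m (leqnn m); rewrite take_oversize // size_enum_ord.
Qed.

End GEPP.

Local Open Scope classical_set_scope.

Definition measurable_mx_display : measure_display -> measure_display.
Proof. exact. Qed.

(* Product sigma-algebra on matrices, i.e. the one generated by the entries. *)
Section measurable_matrix.
Context {d} {T : measurableType d} (m n : nat).

Definition mx_entries_sigma : set (set 'M[T]_(m, n)) :=
  <<s \bigcup_(ij in [set: 'I_m * 'I_n])
        preimage_set_system setT (fun A : 'M[T]_(m, n) => A ij.1 ij.2)
          measurable >>.

Let mx_set0 : mx_entries_sigma set0.
Proof. exact: sigma_algebra0. Qed.

Let mx_setC A : mx_entries_sigma A -> mx_entries_sigma (~` A).
Proof. exact: sigma_algebraC. Qed.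

Let mx_bigcup (F : (set 'M[T]_(m, n))^nat) :
  (forall i, mx_entries_sigma (F i)) -> mx_entries_sigma (\bigcup_i (F i)).
Proof. exact: sigma_algebra_bigcup. Qed.

HB.instance Definition _ := @isMeasurable.Build (measurable_mx_display d)
  'M[T]_(m, n) mx_entries_sigma mx_set0 mx_setC mx_bigcup.

End measurable_matrix.

Lemma measurable_entry d (T : measurableType d) m n i j :
  measurable_fun setT (fun A : 'M[T]_(m, n) => A i j).
Proof.
move=> _ Y mY; apply: sub_sigma_algebra; exists (i, j) => //=.
by exists Y.
Qed.

Lemma measurable_fun_mx d1 (T1 : measurableType d1) d (T : measurableType d)
    m n (f : T1 -> 'M[T]_(m, n)) :
  (forall i j, measurable_fun setT (fun x => f x i j)) -> measurable_fun setT f.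
Proof.
move=> mf; apply: (measurability (\bigcup_(ij in [set: 'I_m * 'I_n])
  preimage_set_system setT (fun A : 'M[T]_(m, n) => A ij.1 ij.2) measurable)) => //.
move=> _ [_ [[i j] _ [Y mY <-]] <-]; rewrite !setTI /=.
by rewrite -[X in measurable X]setTI; exact: mf.
Qed.

Section Butterfly_matrices.
Variable R : realType.

Definition rotation (theta : R) : 'M[R]_2 :=
  \matrix_(i, j) if i == j then cos theta
                 else if i == 0 then sin theta else - sin theta.

Definition butterfly_mx n
    (x : measurableTypeR R * ('M[R]_(2 ^ n) * 'M[R]_(2 ^ n))) : 'M[R]_(2 ^ n.+1) :=
  castmx (esym (expnS 2 n), esym (expnS 2 n)) (rotation x.1 *t 1%:M)
    *m castmx (double_exp n, double_exp n) (block_mx x.2.1 0 0 x.2.2).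

Lemma measurable_rotation i j : measurable_fun setT (fun t => rotation t i j).
Proof.
under eq_fun do rewrite mxE.
have mcos : measurable_fun setT (@cos R).
  by apply: continuous_measurable_fun; exact: continuous_cos.
have msin : measurable_fun setT (@sin R).
  by apply: continuous_measurable_fun; exact: continuous_sin.
case: (i == j) => //; case: (i == 0) => //.
exact: measurableT_comp.
Qed.

Lemma measurable_butterfly_mx n : measurable_fun setT (@butterfly_mx n).
Proof.
apply: measurable_fun_mx => i j; under eq_fun do rewrite mxE.
apply: measurable_sum => k; apply: measurable_funM.
  under eq_fun do rewrite castmxE mxE.
  apply: measurable_funM => //.
  by apply: (measurableT_comp (measurable_rotation _ _)).
under eq_fun do rewrite castmxE.
case: (split_ordP (cast_ord (esym (double_exp n)) k)) => a ->;
  case: (split_ordP (cast_ord (esym (double_exp n)) j)) => b ->.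
- apply: (eq_measurable_fun
    ((fun A : 'M[R]_(2 ^ n) => A a b) \o (fst \o snd))).
    by move=> x _ /=; rewrite block_mxEul.
  exact: (measurableT_comp (measurable_entry a b)
    (measurableT_comp measurable_fst measurable_snd)).
- under eq_fun do rewrite block_mxEur mxE.
  exact: measurable_cst.
- under eq_fun do rewrite block_mxEdl mxE.
  exact: measurable_cst.
- apply: (eq_measurable_fun
    ((fun A : 'M[R]_(2 ^ n) => A a b) \o (snd \o snd))).
    by move=> x _ /=; rewrite block_mxEdr.
  exact: (measurableT_comp (measurable_entry a b)
    (measurableT_comp measurable_snd measurable_snd)).
Qed.

HB.instance Definition _ n := isMeasurableFun.Build _ _ _ _ (@butterfly_mx n)
  (@measurable_butterfly_mx n).

Lemma pi2_gt0 : (0 : R) < 2 * pi.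
Proof. by rewrite mulr_gt0 // pi_gt0. Qed.

(* [uniform_prob] lives on the closed interval; the endpoint [2 * pi] is null. *)
Definition uniform_angle : probability (measurableTypeR R) R := uniform_prob pi2_gt0.

(* The product measure encodes the independence of the angle and of the two
   half-size matrices. *)
Fixpoint butterfly_law n : probability 'M[R]_(2 ^ n) R :=
  if n is k.+1 then
    distribution (uniform_angle \x (butterfly_law k \x butterfly_law k))%E
      (@butterfly_mx k)
  else dirac (1%:M : 'M[R]_(2 ^ 0)).

End Butterfly_matrices.

Definition uniform_on d (T : measurableType d) (R : realType)
    (P : probability T R) (I : finType) (X : T -> I) (S : {set I}) : Prop :=
  forall i : I, measurable (X @^-1` [set i]) /\
    P (X @^-1` [set i]) = (if i \in S then #|S|%:R^-1 else 0 : R)%:E.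

(* Main.v *)
Require Import Defs.
From mathcomp Require Import all_boot all_order all_algebra all_fingroup.
From mathcomp Require Import mxtens ring lra.
From mathcomp Require Import all_classical all_reals all_analysis.
From mathcomp Require Import measurable_realfun.

(** Call a row permutation strict for an invertible matrix A when the permuted
    matrix factors as L U with L unit lower triangular and every entry of L
    below the diagonal of absolute value less than 1. Then partial pivoting has
    no freedom: at each step the pivot is the unique entry of largest absolute
    value, so the rule for breaking ties is irrelevant and the algorithm returns
    that permutation ([gepp_perm_strict]).

    Strictness is inherited by butterflies. Put the blocks of
    (R_x (x) I)(A1 (+) A2) in the order, chosen by a permutation t of the two
    block rows, that makes the larger of |cos x| and |sin x| come first. The
    matrix is then [a A1, b A2; e A1, f A2] with |e| < |a|, and from strict
    factorizations P1 A1 = L1 U1 and P2 A2 = L2 U2 one reads off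
      L = [L1, 0; (e/a) P2 P1^-1 L1, L2],
      U = [a U1, b L1^-1 P1 A2; 0, (f - e b / a) U2];
    the new entries of L are e/a times entries of L1, hence less than 1 in
    absolute value ([strict_pivoting_block], [strict_pivoting_tens]). So the
    butterfly with angle x has the strict permutation built from t, s1 and s2
    whenever t is the order dictated by x and s1, s2 are strict for A1, A2.

    Each of the two orders t is dictated by a set of angles of probability 1/2
    ([outer_ge_dominant_angle]), and t, s1, s2 are independent. By induction
    each member of B_N is strict with probability at least 1 / #|B_N|, the count
    #|B_2N| = 2 #|B_N|^2 resting on the fact that the triple can be read off the
    permutation ([butterfly_perm_inj]). As the probabilities of the values of
    sigma(B) add up to 1, these lower bounds are equalities
    ([uniform_on_ge]).

    Being strict is an existential condition over real matrices, so it does not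
    define a set that is visibly measurable. For this reason the induction
    bounds outer probabilities, that is, the probabilities of all measurable
    supersets ([outer_ge]); it is applied to the events gepp_perm A = s, which
    contain the strict ones and are measurable ([measurable_gepp_perm]). *)

Set Implicit Arguments.
Unset Strict Implicit.
Unset Printing Implicit Defensive.

Import Order.TTheory GRing.Theory Num.Theory.
Import numFieldNormedType.Exports.
Local Open Scope ring_scope.

(** * Strict pivoting determines the permutation *)

Section StrictPivoting.
Variables (R : realFieldType) (m : nat).
Implicit Types (A L U V : 'M[R]_m) (s t : 'S_m) (k : 'I_m).

Definition strict_pivoting s A : Prop := exists L U,
  [/\ unit_lower L, (forall i j : 'I_m, (j < i)%N -> `|L i j| < 1),
      upper U, (forall i, U i i != 0) & pmatrix R s *m A = L *m U].

Lemma ord_le_neq (i j : 'I_m) : (i <= j)%N -> j != i -> (i < j)%N.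
Proof. by move=> ij ji; rewrite ltn_neqAle ij andbT eq_sym. Qed.

Lemma pmatrix_mulE s A i j : (pmatrix R s *m A) (s i) j = A i j.
Proof.
rewrite mxE (bigD1 i) //= mxE eqxx mul1r big1 ?addr0 // => l li.
by rewrite mxE (inj_eq perm_inj) eq_sym (negPf li) mul0r.
Qed.

Lemma gepp_pivot_strict k A (p : 'I_m) : (k <= p)%N ->
  (forall i : 'I_m, (k <= i)%N -> i != p -> `|A i k| < `|A p k|) ->
  gepp_pivot k A = p.
Proof.
move=> kp pmax; have [] := gepp_pivotP k A.
rewrite inE => /andP[kq /forallP/(_ p)/implyP/(_ kp) qmax] _.
apply/eqP/negPn/negP => /(pmax _ kq).
by rewrite ltNge qmax.
Qed.

(** The first [n] columns of [L] replaced by those of the identity: after [n]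
    steps of elimination this is the lower factor that remains. *)
Definition partial_lower L n : 'M[R]_m :=
  \matrix_(i, j) if (n <= j)%N then L i j else (i == j)%:R.

(** The states reachable when the pivots are those prescribed by [s]. The
    permutation [q] is what is left of [s] to carry out; the current matrix is
    determined by [q]: its rows are those of the partially eliminated
    [L *m U], in the order that the remaining swaps will undo. *)
Definition strict_state s L U n (st : 'M[R]_m * 'S_m) :=
  exists q : 'S_m, [/\ s = (st.2 * q)%g,
    (forall i : 'I_m, (i < n)%N -> q i = i) &
    st.1 = row_perm q (partial_lower L n *m U)].

(** From row [k] down, column [k] of the current matrix is a permutation of
    column [k] of [L] scaled by [U k k]. Its unique largest entry is the one coming
    from the diagonal of [L], in row [q^-1 k]; swapping it into place makes [q]
    fix [k], and the multipliers of the elimination are then the entries of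
    column [k] of [L], so subtracting the pivot row removes that column. *)
Lemma strict_state_step s L U k st : unit_lower L ->
    (forall i j : 'I_m, (j < i)%N -> `|L i j| < 1) -> upper U ->
    (forall i, U i i != 0) ->
  strict_state s L U k st -> strict_state s L U k.+1 (gepp_step st k).
Proof.
move=> [L1 L0] Llt U0 Unz [q [sE qfix]].
case: st sE => V t /= sE VE.
have qge (i : 'I_m) : (k <= i)%N -> (k <= q i)%N.
  move=> ki; rewrite leqNgt; apply/negP => qik.
  by have /perm_inj qi := qfix _ qik; rewrite qi ltnNge ki in qik.
have colk i : (k <= q i)%N -> V i k = L (q i) k * U k k.
  move=> kqi; rewrite VE !mxE (bigD1 k) //= mxE leqnn big1 ?addr0 // => l lk.
  rewrite mxE; case: leqP => kl.
    by rewrite U0 ?mulr0 // ord_le_neq.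
  by rewrite -val_eqE /= gtn_eqF ?mul0r // (leq_trans kl).
set p := (q^-1)%g k; have qp : q p = k by rewrite permKV.
have kp : (k <= p)%N.
  rewrite leqNgt; apply/negP => pk.
  by have := qfix _ pk; rewrite qp => E; rewrite E ltnn in pk.
have pivot : gepp_pivot k V = p.
  apply: gepp_pivot_strict => // i ki ip.
  rewrite colk ?qge // colk ?qp // L1 mul1r normrM gtr_pMl ?normr_gt0 //.
  apply: Llt; apply: ord_le_neq; rewrite ?qge //.
  by apply: contra ip => /eqP qi; rewrite /p -qi permK.
rewrite /gepp_step /= pivot.
exists (tperm k p * q)%g; split=> /=.
- by rewrite mulgA -[X in _ = (X * _)%g]mulgA tperm2 mulg1.
- move=> i; rewrite ltnS leq_eqVlt permM => /orP[/eqP/val_inj ->|ik].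
    by rewrite tpermL.
  by rewrite tpermD ?qfix // -val_eqE /= gtn_eqF // (leq_trans ik).
set q' := (tperm k p * q)%g.
have q'fix (i : 'I_m) : (i <= k)%N -> q' i = i.
  rewrite leq_eqVlt => /orP[/eqP/val_inj ->|ik]; first by rewrite permM tpermL.
  by rewrite permM tpermD ?qfix // -val_eqE /= gtn_eqF // (leq_trans ik).
have q'gt (i : 'I_m) : (k < i)%N -> (k < q' i)%N.
  move=> ki; rewrite ltnNge; apply/negP => q'k.
  by have /perm_inj E := q'fix _ q'k; rewrite E leqNgt ki in q'k.
set V' := xrow k p V.
have V'E i j : V' i j = (partial_lower L k *m U) (q' i) j.
  by rewrite /V' /xrow VE -row_permM [LHS]mxE.
have V'k (i : 'I_m) : (k <= i)%N -> V' i k = L (q' i) k * U k k.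
  move=> ki; rewrite /V' /xrow mxE colk -permM //.
  move: ki; rewrite leq_eqVlt => /orP[/eqP/val_inj <-|/q'gt/ltnW//].
  by rewrite q'fix.
have rowk j : V' k j = U k j.
  rewrite V'E q'fix // mxE (bigD1 k) //= mxE leqnn L1 mul1r big1 ?addr0 //.
  move=> l lk; rewrite mxE; case: ifP => kl.
    by rewrite L0 ?mul0r // ord_le_neq.
  by rewrite eq_sym (negPf lk) mul0r.
apply/matrixP => i j; rewrite [LHS]mxE [RHS]mxE.
have [ki|ik] := ltnP k i.
  rewrite !V'k ?(ltnW ki) // (q'fix k) // L1 mul1r mulfK // rowk V'E.
  rewrite !mxE (bigD1 k) //= [in RHS](bigD1 k) //= !mxE leqnn ltnn.
  rewrite -val_eqE /= gtn_eqF ?q'gt // mul0r add0r [LHS]addrC addKr.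
  apply: eq_bigr => l lk; rewrite !mxE leq_eqVlt.
  by rewrite (_ : (k == l :> nat) = false) //; apply/negbTE; rewrite eq_sym.
rewrite V'E q'fix // !mxE; apply: eq_bigr => l _; congr (_ * _); rewrite !mxE.
case: (ltngtP k l) => // /val_inj <-.
have [->|ik'] := eqVneq i k; first by rewrite L1.
by rewrite L0 // ord_le_neq // eq_sym.
Qed.

(** In the initial state nothing has been eliminated and [q = s]; in the final
    one [q] fixes everything, so all of [s] has been carried out. *)
Lemma gepp_perm_strict s A : strict_pivoting s A -> gepp_perm A = s.
Proof.
move=> [L [U [Lu Llt Uu Unz PA]]].
suff [q [-> qfix _]] : strict_state s L U m (gepp A).
  have -> : q = 1%g by apply/permP => i; rewrite qfix ?perm1.
  by rewrite mulg1.
have H n : (n <= m)%N ->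
    strict_state s L U n (foldl (@gepp_step R m) (A, 1%g) (take n (enum 'I_m))).
  elim: n => [_|n IH nm].
    rewrite take0 /=; exists s; split=> //=; first by rewrite mul1g.
    rewrite [partial_lower _ _](_ : _ = L) -?PA; last first.
      by apply/matrixP => i j; rewrite mxE.
    by apply/matrixP => i j; rewrite [RHS]mxE pmatrix_mulE.
  rewrite (take_nth (Ordinal nm)) ?size_enum_ord // -cats1 foldl_cat /=.
  set k := nth _ _ _; have kn : n = k by rewrite /k nth_enum_ord.
  rewrite [in n.+1]kn; apply: strict_state_step => //; rewrite -kn.
  exact: IH (ltnW nm).
by have := H m (leqnn m); rewrite take_oversize // size_enum_ord.
Qed.

End StrictPivoting.

(** * Strict pivoting of a butterfly matrix *)

Section BlockPivoting.
Variable R : realFieldType.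

Lemma strict_pivoting_cast m m' (e : m = m') (s : 'S_m) (A : 'M[R]_m) :
  strict_pivoting s A -> strict_pivoting (cast_perm e s) (castmx (e, e) A).
Proof. by case: m' / e; rewrite castmx_id. Qed.

Lemma strict_pivoting_mulg m (s t : 'S_m) (A : 'M[R]_m) :
  strict_pivoting s (pmatrix R t *m A) -> strict_pivoting (t * s)%g A.
Proof.
by move=> [L [U [? ? ? ? E]]]; exists L, U; split; rewrite // pmatrixM -mulmxA.
Qed.

Lemma pmatrix_cast m m' (e : m = m') (s : 'S_m) :
  pmatrix R (cast_perm e s) = castmx (e, e) (pmatrix R s).
Proof. by case: m' / e; rewrite castmx_id. Qed.

Lemma unit_lower_unitmx m (L : 'M[R]_m) : unit_lower L -> L \in unitmx.
Proof.
move=> [L1 L0]; rewrite unitmxE det_trig; last exact/is_trig_mxP.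
by rewrite big1 ?unitr1 // => i _; rewrite L1.
Qed.

(** The Schur complement of [a *: A1] is [(f - e / a * b) *: A2], because the
    factor [A1] in the lower left block cancels; so the second half of the
    elimination is that of [A2] up to a scalar. The hypothesis [`|e| < `|a|] is
    what keeps the multipliers of the first half below 1 in absolute value,
    also in the rows where [L1] has a diagonal entry 1. *)
Lemma strict_pivoting_block m (s1 s2 : 'S_m) (A1 A2 : 'M[R]_m) (a b e f : R) :
    `|e| < `|a| -> a * f - b * e != 0 ->
    strict_pivoting s1 A1 -> strict_pivoting s2 A2 ->
  strict_pivoting (osum s1 s2)
    (block_mx (a *: A1) (b *: A2) (e *: A1) (f *: A2)).
Proof.
move=> ea det0 [L1 [U1 [Lu1 Llt1 Uu1 Unz1 PA1]]].
move=> [L2 [U2 [Lu2 Llt2 Uu2 Unz2 PA2]]].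
have a0 : a != 0 by rewrite -normr_gt0 (le_lt_trans _ ea).
have L1unit := unit_lower_unitmx Lu1.
have L1le i j : `|L1 i j| <= 1.
  have [ij|ji|/val_inj ->] := ltngtP i j.
  - by rewrite (proj2 Lu1) // normr0.
  - exact/ltW/Llt1.
  - by rewrite (proj1 Lu1) normr1.
(* Reorders the rows of [A1] from the order [s1] to the order [s2]. *)
pose Q := pmatrix R (s1^-1 * s2)%g.
have QP : Q *m pmatrix R s1 = pmatrix R s2.
  by rewrite -pmatrixM mulgA mulgV mul1g.
exists (block_mx L1 0 ((e / a) *: (Q *m L1)) L2).
exists (block_mx (a *: U1) (b *: (invmx L1 *m pmatrix R s1 *m A2)) 0
                 ((f - e / a * b) *: U2)).
split.
- split=> [i|i j].
    by case: (split_ordP i) => i' ->; rewrite ?block_mxEul ?block_mxEdr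
      ?(proj1 Lu1) ?(proj1 Lu2).
  case: (split_ordP i) => i' ->; case: (split_ordP j) => j' -> /= ij;
    rewrite ?block_mxEul ?block_mxEur ?block_mxEdl ?block_mxEdr ?mxE.
  + exact: (proj2 Lu1).
  + by [].
  + by move: ij; rewrite ltnNge (leq_trans (ltnW (ltn_ord j'))) ?leq_addr.
  + by apply: (proj2 Lu2); rewrite ltn_add2l in ij.
- move=> i j.
  case: (split_ordP i) => i' ->; case: (split_ordP j) => j' -> /= ij;
    rewrite ?block_mxEul ?block_mxEur ?block_mxEdl ?block_mxEdr.
  + exact: Llt1.
  + by rewrite mxE normr0.
  + rewrite mxE -[i'](permKV (s1^-1 * s2)%g) pmatrix_mulE normrM.
    rewrite (le_lt_trans (ler_piMr _ (L1le _ _))) // normrM normfV.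
    by rewrite ltr_pdivrMr ?normr_gt0 // mul1r.
  + by apply: Llt2; rewrite ltn_add2l in ij.
- move=> i j.
  case: (split_ordP i) => i' ->; case: (split_ordP j) => j' -> /= ij;
    rewrite ?block_mxEul ?block_mxEur ?block_mxEdl ?block_mxEdr ?[LHS]mxE //.
  + by rewrite Uu1 ?mulr0.
  + by move: ij; rewrite ltnNge (leq_trans (ltnW (ltn_ord i'))) ?leq_addr.
  + by rewrite ltn_add2l in ij; rewrite Uu2 ?mulr0.
- move=> i; case: (split_ordP i) => i' ->;
    rewrite ?block_mxEul ?block_mxEdr mxE mulf_neq0 //.
  apply: contra det0 => /eqP E; apply/eqP.
  (* A zero on the second half of the diagonal makes the Schur coefficient
     vanish, hence also the 2 x 2 determinant. *)
  transitivity (a * (f - e / a * b)); first by field.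
  by rewrite E mulr0.
- rewrite pmatrix_osum !mulmx_block !mul0mx !mulmx0 !addr0 !add0r.
  have LM : L1 *m (invmx L1 *m pmatrix R s1 *m A2) = pmatrix R s1 *m A2.
    by rewrite !mulmxA mulmxV // mul1mx.
  have QA : Q *m L1 *m U1 = pmatrix R s2 *m A1.
    by rewrite -mulmxA -PA1 mulmxA QP.
  have QLM : Q *m L1 *m (invmx L1 *m pmatrix R s1 *m A2) = pmatrix R s2 *m A2.
    by rewrite -mulmxA LM mulmxA QP.
  congr block_mx; rewrite -?scalemxAr -?scalemxAl -?scalemxAr ?scalerA.
  + by rewrite PA1.
  + by rewrite LM.
  + by rewrite QA; congr (_ *: _); field.
  + by rewrite QLM -PA2 -scalerDl; congr (_ *: _); field.
Qed.

Lemma tensmx_block m N (e1 : (2 * m = N)%N) (e2 : (m + m = N)%N) (M : 'M[R]_2) :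
  castmx (e1, e1) (M *t 1%:M) =
  castmx (e2, e2) (block_mx (M 0 0)%:M (M 0 1)%:M (M 1 0)%:M (M 1 1)%:M).
Proof.
case: N / e2 e1 => e1; rewrite castmx_id.
have lcast (k : 'I_m) : cast_ord (esym e1) (lshift m k) = mxtens_index (0, k).
  by apply: val_inj; rewrite /= mul0n.
have rcast (k : 'I_m) : cast_ord (esym e1) (rshift m k) = mxtens_index (1, k).
  by apply: val_inj; rewrite /= mul1n.
apply/matrixP => i j; rewrite castmxE /=.
case: (split_ordP i) => i' ->; case: (split_ordP j) => j' ->;
  by rewrite ?lcast ?rcast tensmxE ?block_mxEul ?block_mxEur ?block_mxEdl
    ?block_mxEdr !mxE mulr_natr.
Qed.

Lemma mulmx_cast m N (e : m = N) (A B : 'M[R]_m) :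
  castmx (e, e) A *m castmx (e, e) B = castmx (e, e) (A *m B).
Proof. by case: N / e; rewrite !castmx_id. Qed.

Definition butterfly_perm n (t : 'S_2) (s1 s2 : 'S_(2 ^ n)) : 'S_(2 ^ n.+1) :=
  (cast_perm (esym (expnS 2 n)) (tens t (1 : 'S_(2 ^ n))%g)
   * cast_perm (double_exp n) (osum s1 s2))%g.

Lemma tensmx_mul_block n (M : 'M[R]_2) (A1 A2 : 'M[R]_(2 ^ n)) :
  castmx (esym (expnS 2 n), esym (expnS 2 n)) (M *t 1%:M)
    *m castmx (double_exp n, double_exp n) (block_mx A1 0 0 A2) =
  castmx (double_exp n, double_exp n)
    (block_mx (M 0 0 *: A1) (M 0 1 *: A2) (M 1 0 *: A1) (M 1 1 *: A2)).
Proof.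
rewrite (tensmx_block _ (double_exp n)) mulmx_cast mulmx_block.
by rewrite !mulmx0 !mul_scalar_mx !addr0 !add0r.
Qed.

Lemma det_mx22 (M : 'M[R]_2) : \det M = M 0 0 * M 1 1 - M 0 1 * M 1 0.
Proof.
rewrite (expand_det_row _ 0) big_ord_recl big_ord1 /cofactor !det_mx11 !mxE /=.
rewrite expr0 expr1 mul1r mulN1r mulrN.
by congr (_ * M _ _ - M _ _ * M _ _); apply: val_inj.
Qed.

Lemma ord2_cases (i : 'I_2) : i = 0 \/ i = 1.
Proof. by case: i => [[|[|//]] ?]; [left | right]; apply: val_inj. Qed.

Lemma pmatrix_inj m : injective (@pmatrix R m).
Proof.
move=> u v uv; apply/permP => k; have /matrixP/(_ (u k) k) := uv.
by rewrite !mxE eqxx; case: eqP => // _ /eqP; rewrite oner_eq0.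
Qed.

Lemma pmatrix1 m : pmatrix R (1%g : 'S_m) = 1%:M.
Proof. by rewrite pmatrixE invg1 perm_mx1. Qed.

(** The permutation [t] of the two block rows acts on the 2 x 2 factor alone, so
    the choice between the two orders is a pivot choice for [M]. *)
Lemma strict_pivoting_tens n (M : 'M[R]_2) (t : 'S_2) (s1 s2 : 'S_(2 ^ n))
    (A1 A2 : 'M[R]_(2 ^ n)) : M \in unitmx ->
    `|(pmatrix R t *m M) 1 0| < `|(pmatrix R t *m M) 0 0| ->
    strict_pivoting s1 A1 -> strict_pivoting s2 A2 ->
  strict_pivoting (butterfly_perm t s1 s2)
    (castmx (esym (expnS 2 n), esym (expnS 2 n)) (M *t 1%:M)
       *m castmx (double_exp n, double_exp n) (block_mx A1 0 0 A2)).
Proof.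
move=> Mu Mlt S1 S2; apply: strict_pivoting_mulg.
rewrite pmatrix_cast mulmxA mulmx_cast pmatrix_tens tensmx_mul pmatrix1 mul1mx.
rewrite tensmx_mul_block; apply: strict_pivoting_cast.
apply: strict_pivoting_block => //.
have : pmatrix R t *m M \in unitmx.
  by rewrite unitmx_mul Mu pmatrixE unitmx_perm.
by rewrite unitmxE unitfE det_mx22.
Qed.

(** The permutation matrix has blocks [pmatrix R t i j *: P_i], with exactly one
    nonzero block in each block row: summing a block row gives [P_i], and the
    position of the nonzero block gives [t]. *)
Lemma butterfly_perm_inj n (t t' : 'S_2) (s1 s2 s1' s2' : 'S_(2 ^ n)) :
  butterfly_perm t s1 s2 = butterfly_perm t' s1' s2' ->
  [/\ t = t', s1 = s1' & s2 = s2'].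
Proof.
move/(congr1 (@pmatrix R _)); rewrite /butterfly_perm !pmatrixM !pmatrix_cast.
rewrite !pmatrix_osum !pmatrix_tens !pmatrix1 !(tensmx_block _ (double_exp n)).
rewrite !mulmx_cast => /(can_inj (castmxK _ _)).
rewrite !mulmx_block !mul0mx !mul_mx_scalar !addr0 !add0r => /eq_block_mx[].
have rowsum (u : 'S_2) i : pmatrix R u i 0 + pmatrix R u i 1 = 1.
  rewrite -[i](permKV u) !mxE !(inj_eq perm_inj).
  by case: ((u^-1)%g i) => [[|[|//]] ?]; rewrite ?add0r ?addr0.
have gather (u u' : 'S_2) i (P P' : 'M[R]_(2 ^ n)) :
    pmatrix R u i 0 *: P = pmatrix R u' i 0 *: P' ->
    pmatrix R u i 1 *: P = pmatrix R u' i 1 *: P' -> P = P'.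
  move=> E0 E1; rewrite -[P]scale1r -(rowsum u i) scalerDl E0 E1 -scalerDl.
  by rewrite rowsum scale1r.
move=> E00 E01 E10 E11.
have /pmatrix_inj s1E := gather _ _ _ _ _ E00 E01.
have /pmatrix_inj s2E := gather _ _ _ _ _ E10 E11.
subst s1' s2'; split=> //; apply: pmatrix_inj.
have coef (c c' : R) (u : 'S_(2 ^ n)) :
    c *: pmatrix R u = c' *: pmatrix R u -> c = c'.
  have n0 : (0 < 2 ^ n)%N by rewrite expn_gt0.
  move/matrixP/(_ (u (Ordinal n0)) (Ordinal n0)).
  by rewrite !mxE eqxx !mulr1.
by apply/matrixP => i j; case: (ord2_cases i) => ->; case: (ord2_cases j) => ->;
  [apply: coef E00 | apply: coef E01 | apply: coef E10 | apply: coef E11].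
Qed.

End BlockPivoting.

(** * Counting the butterfly permutations *)

Section ButterflyPermutations.

Lemma butterfly_perm_stepE n (G : {set 'S_(2 ^ n)}) :
  butterfly_perm_step G =
  [set butterfly_perm x.1 x.2.1 x.2.2
     | x in finset.setX [set: 'S_2] (finset.setX G G)]%SET.
Proof.
apply/setP => s; rewrite inE; apply/idP/imsetP.
  case/existsP => s1 /andP[s1G /existsP[s2 /andP[s2G /existsP[t /eqP ->]]]].
  by exists (t, (s1, s2)); rewrite // !inE s1G s2G.
case=> -[t [s1 s2]] /=; rewrite !inE /= => /andP[s1G s2G] ->.
apply/existsP; exists s1; rewrite s1G; apply/existsP; exists s2.
by rewrite s2G; apply/existsP; exists t.
Qed.

Lemma card_butterfly_perm_step n (G : {set 'S_(2 ^ n)}) :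
  #|butterfly_perm_step G| = (2 * (#|G| * #|G|))%N.
Proof.
rewrite butterfly_perm_stepE card_in_imset ?cardsX ?cardsT ?card_Sn //.
(* The field carrying the permutation matrices is arbitrary. *)
move=> [t [s1 s2]] [t' [s1' s2']] _ _ /(@butterfly_perm_inj rat)/=.
by case=> -> -> ->.
Qed.

(** For [n = 0] the recursion must produce all of [S_2], and does so by counting:
    the trivial group gives 2 distinct permutations. *)
Lemma butterfly_permsS n :
  butterfly_perms n.+1 = butterfly_perm_step (butterfly_perms n).
Proof.
case: n => [|n] //=; apply/esym/eqP; rewrite eqEcard finset.subsetT.
by rewrite card_butterfly_perm_step !cardsT !card_Sn.
Qed.

Lemma card_butterfly_perms_gt0 n : (0 < #|butterfly_perms n|)%N.
Proof.
elim: n => [|n IH]; first by rewrite cardsT card_Sn fact_gt0.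
by rewrite butterfly_permsS card_butterfly_perm_step !muln_gt0 IH.
Qed.

End ButterflyPermutations.

(** * Lower bounds on outer probabilities *)

Local Open Scope classical_set_scope.

Section OuterProbability.
Variable R : realType.

(** [a] is a lower bound of the outer probability of [S]. *)
Definition outer_ge d (T : measurableType d) (P : probability T R) (S : set T)
    (a : R) : Prop :=
  forall H, measurable H -> S `<=` H -> (a%:E <= P H)%E.

(** For a measurable [H] containing [S1 `*` S2], the sections of [H] at points of
    [S1] contain [S2]. So the points whose section has probability at least [b]
    form a measurable set containing [S1], and Fubini concludes. *)
Lemma outer_ge_prod d1 d2 (T1 : measurableType d1) (T2 : measurableType d2)
    (P1 : probability T1 R) (P2 : probability T2 R) S1 S2 (a b : R) :
  0 <= b -> outer_ge P1 S1 a -> outer_ge P2 S2 b ->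
  outer_ge (P1 \x P2)%E (S1 `*` S2) (a * b).
Proof.
move=> b0 S1a S2b H mH SH.
pose X := [set x | (b%:E <= P2 (xsection H x))%E].
have mX : measurable X.
  rewrite -[X]setTI; apply: emeasurable_fun_c_infty => //.
  exact: measurable_fun_xsection.
have aX : (a%:E <= P1 X)%E.
  apply: S1a => // x S1x; apply: S2b; first exact: measurable_xsection.
  by move=> y S2y; rewrite /xsection /= inE; apply: SH.
rewrite /product_measure1 /=.
apply: (@le_trans _ _ (\int[P1]_(x in X) cst b%:E x)%E).
  by rewrite integral_cst // EFinM muleC lee_wpmul2l.
apply: (@le_trans _ _ (\int[P1]_(x in X) (P2 \o xsection H) x)%E).
  apply: ge0_le_integral => //.
  by apply: measurable_funTS; exact: measurable_fun_xsection.
apply: ge0_subset_integral => //.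
exact: measurable_fun_xsection.
Qed.

End OuterProbability.

(** * The angles for which a given block order is the pivoting order *)

Section Angle.
Variable R : realType.
Local Notation pi := (@pi R).

Lemma uniform_angle_itv (a b : R) : 0 <= a -> a < b -> b <= 2 * pi ->
  uniform_angle R `]a, b[ = ((b - a) / (2 * pi))%:E.
Proof.
move=> a0 ab b2; rewrite /uniform_angle /= /uniform_prob integral_uniform_pdf.
have -> : `]a, b[ `&` `[0, 2 * pi] = `]a, b[.
  by apply/seteqP; split=> x /=; rewrite !in_itv /=; [case|]; lra.
rewrite (eq_integral (cst (2 * pi)^-1%:E)); last first.
  move=> x; rewrite inE /= in_itv /= => /andP[ax xb].
  rewrite /uniform_pdf subr0.
  by rewrite (le_trans a0 (ltW ax)) (le_trans (ltW xb) b2).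
rewrite integral_cst //= lebesgue_measure_itv /= lte_fin ab -EFinD -EFinM.
by rewrite mulrC.
Qed.

(** The angles at which partial pivoting of the 2 x 2 rotation itself reorders
    the rows by [t], without a tie. *)
Definition dominant_angle (t : 'S_2) : set R :=
  [set x | `|(pmatrix R t *m rotation x) 1 0| <
           `|(pmatrix R t *m rotation x) 0 0|].

Lemma norm_lt_sqr (x y : R) : x ^+ 2 < y ^+ 2 -> `|x| < `|y|.
Proof.
rewrite -[x ^+ 2]real_normK ?num_real // -[y ^+ 2]real_normK ?num_real //.
by rewrite ltr_pXn2r // ?nnegrE.
Qed.

Lemma cos_double_sign (x : R) (j : nat) :
  (j%:R - 2^-1) * pi < x *+ 2 < (j%:R + 2^-1) * pi ->
  0 < (-1) ^+ j * cos (x *+ 2).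
Proof.
elim: j x => [|j IH] x.
  by rewrite expr0 mul1r => ?; apply: cos_gt0_pihalf; lra.
move=> xj; have := IH (x - pi / 2).
have -> : (x - pi / 2) *+ 2 = x *+ 2 - pi by rewrite mulrnBl; lra.
have -> : cos (x *+ 2 - pi) = - cos (x *+ 2).
  by rewrite cosB cospi sinpi; lra.
rewrite exprS mulN1r mulrN -mulNr; apply.
by move: xj; rewrite -natr1; lra.
Qed.

Lemma cos_double_sqr (x : R) : cos (x *+ 2) = cos x ^+ 2 - sin x ^+ 2.
Proof. by rewrite cos_mulr2n; have := cos2Dsin2 x; lra. Qed.

(** [cos (x *+ 2)] is [cos x ^+ 2 - sin x ^+ 2], so its sign tells which of the
    two entries is the larger; the sign in front is 1 when [t] is the identity
    and -1 when it is the transposition. *)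
Lemma dominant_angleP (t : 'S_2) (x : R) :
  0 < (-1) ^+ (t 0 : nat) * cos (x *+ 2) -> dominant_angle t x.
Proof.
have PE (i j : 'I_2) :
    t j = i -> (pmatrix R t *m rotation x) i 0 = rotation x j 0.
  by move=> <-; rewrite pmatrix_mulE.
have t01 : t 0 != t 1 by rewrite (inj_eq perm_inj).
rewrite /dominant_angle /= cos_double_sqr.
case: (ord2_cases (t 0)) (ord2_cases (t 1)) t01 => t0 [] t1;
  rewrite t0 t1 //= => _.
all: rewrite (PE _ _ t0) (PE _ _ t1) !mxE /= normrN => ?.
all: by apply: norm_lt_sqr; lra.
Qed.

Definition octant (k : nat) : set R := `]k%:R * (pi / 4), k.+1%:R * (pi / 4)[.

(** On octant [k] the double angle lies within [pi / 2] of
    [(k.+1)./2%:R * pi]. *)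
Lemma octant_sub_dominant_angle (t : 'S_2) (k : nat) :
  (-1) ^+ (t 0 : nat) = (-1) ^+ (k.+1)./2 :> R ->
  octant k `<=` dominant_angle t.
Proof.
move=> tk x; rewrite /octant /= in_itv /= => /andP[kx xk].
apply: dominant_angleP; rewrite tk; apply: cos_double_sign.
have pi0 := pi_gt0 R.
have := odd_double_half k.+1; set h := (k.+1)./2; rewrite -muln2.
move=> kE; have {kE} : (odd k.+1)%:R + h%:R * 2%:R = k.+1%:R :> R.
  by rewrite -natrM -natrD kE.
move=> kE; move: kx xk.
have -> : k%:R = k.+1%:R - 1 :> R by rewrite -natr1 addrK.
by case: (odd k.+1) kE => <- /=; lra.
Qed.

(** Among the eight octants of the circle, those numbered 0, 3, 4, 7 belong to
    the identity and 1, 2, 5, 6 to the transposition: four each, of probability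
    1/8. *)
Lemma outer_ge_dominant_angle (t : 'S_2) :
  outer_ge (uniform_angle R) (dominant_angle t) (2^-1).
Proof.
move=> H mH tH.
pose S := [pred k : 'I_8 | odd (k.+1)./2 == odd (t 0)].
have SH : \big[setU/set0]_(k < 8 | S k) octant k `<=` H.
  apply: (big_ind (fun Z => Z `<=` H)) => [//|Y Z YH ZH|k /eqP Sk].
    by rewrite subUset.
  apply: subset_trans tH; apply: octant_sub_dominant_angle.
  by rewrite -signr_odd -Sk signr_odd.
have mS k : measurable (octant k) by exact: measurable_itv.
apply: (@le_trans _ _
  (uniform_angle R (\big[setU/set0]_(k < 8 | S k) octant k))).
  rewrite measure_bigsetU_ord_cond; first last.
  - apply/trivIsetP => /= i j _ _; wlog ij : i j / (i < j)%N => [W ij|_].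
      have [lt|lt|/val_inj E] := ltngtP i j; last by rewrite E eqxx in ij.
      - exact: W.
      - by rewrite setIC; apply: W; rewrite // eq_sym.
    rewrite -subset0 => x []; rewrite /octant /= !in_itv /=.
    move=> /andP[_ xi] /andP[jx _].
    have : i.+1%:R * (pi / 4) <= j%:R * (pi / 4).
      by rewrite ler_pM2r ?ler_nat ?divr_gt0 ?pi_gt0.
    by rewrite leNgt (lt_trans jx xi).
  - by move=> k _; exact: mS.
  rewrite (eq_bigr (fun=> (8^-1)%:E)) => [|k _]; last first.
    have pi0 := pi_gt0 R.
    apply: etrans (uniform_angle_itv _ _ _) _.
    - by rewrite mulr_ge0 // divr_ge0 // ltW.
    - by rewrite ltr_pM2r ?ltr_nat ?divr_gt0.
    - have -> : 2 * pi = 8 * (pi / 4) by field.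
      by rewrite ler_pM2r ?ler_nat ?divr_gt0.
    (* [field] would unfold the definition of [pi]. *)
    rewrite -natr1; congr EFin; move: pi pi0 => p p0.
    by field; rewrite gt_eqF.
  rewrite big_mkcond !big_ord_recl big_ord0 /S /=.
  by case: (odd (t 0)) => /=; rewrite !(add0r, addr0) -!EFinD lee_fin; lra.
apply: (le_measure (uniform_angle R)) => //; rewrite inE //.
by apply: bigsetU_measurable => k _; exact: mS.
Qed.

Lemma rotation_unitmx (x : R) : rotation x \in unitmx.
Proof.
rewrite unitmxE det_mx22 !mxE /= mulrN opprK -!expr2.
by rewrite cos2Dsin2 unitr1.
Qed.

End Angle.

(** * Every butterfly permutation is likely enough *)

Section LowerBound.
Variable R : realType.

(** The matrices that are strict for [butterfly_perm t s1 s2] pull back, under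
    [butterfly_mx], to a set containing the product of [dominant_angle t] with
    the matrices strict for [s1] and for [s2]. The angle contributes a
    factor 1/2 and each block a factor [#|butterfly_perms n|^-1]. *)
Lemma outer_ge_strict_pivoting n (s : 'S_(2 ^ n)) : s \in butterfly_perms n ->
  outer_ge (butterfly_law R n) [set A | strict_pivoting s A]
    #|butterfly_perms n|%:R^-1.
Proof.
elim: n s => [|n IH] s.
  move=> _ H mH sH; rewrite /butterfly_law /= diracE mem_set.
    have c0 := card_butterfly_perms_gt0 0.
    by rewrite lee_fin invf_le1 ?ler1n ?ltr0n.
  apply: sH; exists 1%:M, 1%:M; have s1 : s = 1%g.
    apply/permP => i; apply: val_inj; rewrite perm1.
    move: (ltn_ord (s i)) (ltn_ord i); rewrite [X in (_ < X)%N]expn0 !ltnS.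
    by rewrite !leqn0 => /eqP si /eqP i0; exact: etrans si (esym i0).
  have m1 : unit_lower (1%:M : 'M[R]_(2 ^ 0)).
    by split=> [i|i j]; rewrite mxE ?eqxx // -val_eqE /= => /ltn_eqF ->.
  split=> //.
  - by move=> i j ji; rewrite mxE -val_eqE /= gtn_eqF // normr0.
  - by move=> i j ji; rewrite mxE -val_eqE /= gtn_eqF.
  - by move=> i; rewrite mxE eqxx oner_eq0.
  - by rewrite s1 pmatrix1.
rewrite butterfly_permsS card_butterfly_perm_step butterfly_perm_stepE.
case/imsetP => -[t [s1 s2]]; rewrite !inE /= => /andP[s1G s2G] -> H mH sH.
rewrite natrM natrM !invfM.
have := outer_ge_prod _ (@outer_ge_dominant_angle R t)
  (outer_ge_prod _ (IH _ s1G) (IH _ s2G)).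
rewrite /distribution /pushforward /=; apply.
- by rewrite mulr_ge0 // invr_ge0.
- by rewrite invr_ge0.
- rewrite -[X in measurable X]setTI; apply: measurable_butterfly_mx => //.
- move=> [x [A1 A2]] /= [xt [S1 S2]]; apply: sH => /=.
  exact: strict_pivoting_tens (rotation_unitmx x) xt S1 S2.
Qed.

End LowerBound.

(** * Measurability of the pivoting permutation *)

Section MeasurablePivoting.
Context {d : measure_display} {T : measurableType d} {R : realType}.

(** Case analysis on a random choice among finitely many: it suffices to treat
    each fixed choice. Here the choice is the pivot, and once the pivot is fixed
    a step of elimination is a rational function of the entries. *)
Lemma measurable_finite_case (I : finType) (X : T -> I) (Q : I -> set T) :
  (forall i, measurable (X @^-1` [set i])) -> (forall i, measurable (Q i)) ->
  measurable [set x | Q (X x) x].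
Proof.
move=> mX mQ.
have -> : [set x | Q (X x) x] = \bigcup_(i in setT) (X @^-1` [set i] `&` Q i).
  apply/seteqP; split=> [x Qx|x [i _ [/= <- //]]].
  by exists (X x).
apply: fin_bigcup_measurable => [|i _]; first exact: finite_finset.
exact: measurableI.
Qed.

(** Inversion is continuous off 0, and a single point is harmless. *)
Lemma measurable_invr : measurable_fun [set: R] (@GRing.inv R).
Proof.
rewrite -(setUv [set 0]); apply/measurable_funU => //; first exact: measurableC.
split; first exact: measurable_fun_set1.
apply: open_continuous_measurable_fun.
  apply/closed_openC.
  exact/accessible_closed_set1/hausdorff_accessible/Rhausdorff.
by move=> x; rewrite inE /= => /eqP x0; apply: continuousV => //; exact: cvg_id.
Qed.

Variable m : nat.
Implicit Types (k : 'I_m).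

Lemma measurable_gepp_pivot k (V : T -> 'M[R]_m) p :
    (forall i j, measurable_fun setT (fun x => V x i j)) ->
  measurable [set x | gepp_pivot k (V x) = p].
Proof.
move=> mV.
pose C j := [set x | j \in gepp_argmax k (V x)].
have mC j : measurable (C j).
  have [kj|jk] := leqP k j; last first.
    rewrite (_ : C j = set0) //; apply/seteqP; split=> // x.
    by rewrite /C /= inE leqNgt jk.
  have -> : C j = \bigcap_(l in [set l : 'I_m | (k <= l)%N])
      (setT `&` [set x | `|V x l k| <= `|V x j k| ]).
    apply/seteqP; split=> x; rewrite /C /= inE kj /=.
      by move=> /forallP jmax l /= kl; split=> //; apply: (implyP (jmax l)).
    by move=> jmax; apply/forallP => l; apply/implyP => /jmax[].
  apply: fin_bigcap_measurable => [|l _]; first exact: finite_finset.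
  by apply: measurable_fun_le => //; exact: measurableT_comp.
have -> : [set x | gepp_pivot k (V x) = p] =
    C p `&` \bigcap_(j in [set j : 'I_m | (j < p)%N]) ~` C j.
  apply/seteqP; split=> x /=.
    move=> <-; have [pC pmin] := gepp_pivotP k (V x); split=> // j /= jp /pmin.
    by rewrite leqNgt jp.
  have [qC qmin] := gepp_pivotP k (V x); move=> [pC pmin].
  apply/val_inj/eqP; rewrite eqn_leq qmin //= leqNgt; apply/negP => /pmin.
  exact.
apply: measurableI => //; apply: fin_bigcap_measurable => [|j _].
  exact: finite_finset.
exact: measurableC.
Qed.

Definition measurable_state (f : T -> 'M[R]_m * 'S_m) : Prop :=
  (forall i j, measurable_fun setT (fun x => (f x).1 i j)) /\
  (forall s, measurable [set x | (f x).2 = s]).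

Lemma measurable_gepp_step k (f : T -> 'M[R]_m * 'S_m) :
  measurable_state f -> measurable_state (fun x => gepp_step (f x) k).
Proof.
move=> [mV ms]; have mp p := measurable_gepp_pivot k p mV.
split=> [i j _ Y mY|s].
  have mx p a b : measurable_fun setT (fun x => xrow k p (f x).1 a b).
    by under eq_fun do rewrite mxE; exact: mV.
  have mE p :
      measurable_fun setT (fun x => gepp_elim k (xrow k p (f x).1) i j).
    under eq_fun do rewrite mxE; case: (k < i)%N; last exact: mx.
    apply: measurable_funB => //; do 2?apply: measurable_funM => //.
    exact: (measurableT_comp measurable_invr).
  rewrite setTI; apply: (measurable_finite_case
    (Q := fun p => (fun x => gepp_elim k (xrow k p (f x).1) i j) @^-1` Y))
    => // p.
  by rewrite -[X in measurable X]setTI; exact: mE.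
apply: (measurable_finite_case
  (Q := fun p => [set x | ((f x).2 * tperm k p)%g = s])) => // p.
rewrite (_ : [set x | _] = [set x | (f x).2 = (s * tperm k p)%g]) //.
by apply/seteqP; split=> x /= => [<-|->]; rewrite -mulgA tperm2 mulg1.
Qed.

End MeasurablePivoting.

Lemma measurable_gepp_perm (R : realType) m (s : 'S_m) :
  measurable [set A : 'M[R]_m | gepp_perm A = s].
Proof.
suff H (ks : seq 'I_m) (f : 'M[R]_m -> 'M[R]_m * 'S_m) :
    measurable_state f ->
    measurable_state (fun A => foldl (@gepp_step R m) (f A) ks).
  apply: (H (enum 'I_m) (fun A => (A, 1%g)) _).2; split=> /=.
    by move=> i j; exact: measurable_entry.
  move=> t; have [<-|t1] := pselect (1%g = t).
    by rewrite (_ : [set _ | _] = setT) //; apply/seteqP.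
  by rewrite (_ : [set _ | _] = set0) //; apply/seteqP; split=> // A /= /t1.
elim: ks f => [//|k ks IH] f mf /=.
exact/IH/measurable_gepp_step.
Qed.

(** * Uniformity from lower bounds *)

Section UniformCriterion.
Context {d : measure_display} {T : measurableType d} {R : realType}.
Variables (P : probability T R) (I : finType) (X : T -> I).
Hypothesis mX : forall i, measurable (X @^-1` [set i]).

Lemma sum_prob_fibers : \sum_(i : I) fine (P (X @^-1` [set i])) = 1.
Proof.
apply: EFin_inj; rewrite -sumEFin -(probability_setT P).
have -> : [set: T] = \bigcup_(i in [set: I]) X @^-1` [set i].
  by apply/seteqP; split=> x // _; exists (X x).
rewrite measure_fin_bigcup //=; last first.
  apply/trivIsetP => i j _ _ /eqP ij; rewrite -subset0 => x /= [Xi Xj].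
  by apply: ij; rewrite -Xi -Xj.
rewrite (fsbigE (enum I)) ?enum_uniq // => [|i _]; last first.
  by rewrite mem_enum.
rewrite big_enum_cond; apply: eq_big => [i|i _]; first by rewrite in_setT.
by rewrite fineK //; exact: fin_num_measure.
Qed.

(** The claimed values are below the true ones and both sum to 1, so the
    nonnegative differences, summing to 0, all vanish. *)
Lemma uniform_on_ge (S : {set I}) : (0 < #|S|)%N ->
  (forall i, i \in S -> (#|S|%:R^-1%:E <= P (X @^-1` [set i]))%E) ->
  uniform_on P X S.
Proof.
move=> S0 PS i; split; first exact: mX.
pose u (i : I) : R := if i \in S then #|S|%:R^-1 else 0.
have fP j : P (X @^-1` [set j]) = (fine (P (X @^-1` [set j])))%:E.
  by rewrite fineK //; exact: fin_num_measure.
rewrite fP; congr EFin; apply/eqP; rewrite -subr_eq0; apply/eqP.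
apply: (@psumr_eq0P _ _ predT (fun j => fine (P (X @^-1` [set j])) - u j))
  => //.
  move=> j _; rewrite subr_ge0 /u; case: ifP => [/PS|_].
    by rewrite fP lee_fin.
  by rewrite fine_ge0.
rewrite sumrB sum_prob_fibers /u -big_mkcond /= sumr_const.
by rewrite -(mulr_natr #|S|%:R^-1) mulVf ?subrr // pnatr_eq0 -lt0n.
Qed.

End UniformCriterion.

Theorem theorem5 (R : realType) (d : measure_display) (T : measurableType d)
    (P : probability T R) (n : nat) (B : {RV P >-> 'M[R]_(2 ^ n)})
    (n_ge1 : (1 <= n)%N)
    (B_law : forall A : set 'M[R]_(2 ^ n), measurable A ->
       distribution P B A = butterfly_law R n A) :
  uniform_on P (fun w : T => gepp_perm (B w)) (butterfly_perms n).
Proof.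
have mB (s : 'S_(2 ^ n)) :
    measurable ((fun w => gepp_perm (B w)) @^-1` [set s]).
  exact: (measurable_funPTI B (measurable_gepp_perm (R := R) s)).
apply: uniform_on_ge => // [|s sG]; first exact: card_butterfly_perms_gt0.
have := outer_ge_strict_pivoting sG (measurable_gepp_perm (R := R) s)
  (@gepp_perm_strict _ _ s).
by rewrite -B_law //; exact: measurable_gepp_perm.
Qed.
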